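(* Let $f\colon\mathbf{R}^n\to\overline{\mathbf{R}}$ be a symmetric function and let $\alpha>0$. Then the equation $$(f\circ\lambda)_{\alpha}=f_{\alpha}\circ\lambda$$ holds. In addition, the proximal mapping admits the representation, for $X\in\mathbf{S}^n$, $$P_{\alpha}(f\circ \lambda)(X)=\big\{U(\operatorname{Diag} y)U^T: y\in P_{\alpha}f(\lambda(X)),\ U\in \mathcal{O}_X\big\}.$$ Moreover, for any $Y\in P_{\alpha}(f\circ \lambda)(X)$, the matrices $X$ and $Y$ admit a simultaneous ordered spectral decomposition.
   Context: $\overline{\mathbf{R}}=\mathbf{R}\cup\{\pm\infty\}$. $\mathbf{R}^n$ carries the usual dot product. $\mathbf{S}^n$ is the space of real symmetric $n\times n$ matrices with the trace inner product $\langle X,Y\rangle=\operatorname{tr}(XY)$ and the induced Frobenius norm. $\mathcal{O}^n$ is the group of real orthogonal $n\times n$ matrices. $\operatorname{Diag}x$ is the $n\times n$ diagonal matrix with $x$ on its diagonal. $\lambda\colon\mathbf{S}^n\to\mathbf{R}^n$ assigns to $X$ its vector of eigenvalues in nonincreasing order. $\mathcal{O}_X:=\{U\in\mathcal{O}^n: U(\operatorname{Diag}\lambda(X))U^T=X\}$. A function $f\colon\mathbf{R}^n\to\overline{\mathbf{R}}$ is symmetric if $f(\pi x)=f(x)$ for all $x\in\mathbf{R}^n$ and all coordinate permutations $\pi$. For a function $g\colon\mathbf{E}\to\overline{\mathbf{R}}$ on a Euclidean space $\mathbf{E}$ (finite-dimensional real inner product space with induced norm $|\cdot|$) and a parameter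 $\alpha>0$, the Moreau envelope and the proximal mapping are $$g_\alpha(x):=\inf_{y\in\mathbf{E}}\Big\{g(y)+\tfrac1{2\alpha}|y-x|^2\Big\},\qquad P_\alpha g(x):=\operatorname*{argmin}_{y\in\mathbf{E}}\Big\{g(y)+\tfrac1{2\alpha}|y-x|^2\Big\}.$$ Matrices $X,Y\in\mathbf{S}^n$ admit a simultaneous ordered spectral decomposition if there is $U\in\mathcal{O}^n$ with $UXU^T=\operatorname{Diag}\lambda(X)$ and $UYU^T=\operatorname{Diag}\lambda(Y)$.
   Formalization: The argmin in the proximal mapping counts only points attaining the infimum with a finite value (empty if the infimum is ±∞); with infinite values allowed, f identically −∞ or +∞ makes the representation and the ''moreover'' claim false. *)

(* Defs.v *)
From HB Require Import structures.
From mathcomp Require Import all_boot all_order all_algebra all_fingroup.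
From mathcomp Require Import sesquilinear.
From mathcomp Require Import boolp classical_sets reals constructive_ereal ereal.

Set Implicit Arguments.
Unset Strict Implicit.
Unset Printing Implicit Defensive.

Import Order.TTheory GRing.Theory Num.Theory.

Local Open Scope classical_set_scope.
Local Open Scope ring_scope.

Section MoreauEnvelope.
Context {R : realType} {E : lmodType R} (dot : {dot E for idfun}).

Definition enorm (u : E) : R := Num.sqrt (dot u u).

Definition prox_obj (g : E -> \bar R) (alpha : R) (x y : E) : \bar R :=
  (g y + ((2 * alpha)^-1 * enorm (y - x) ^+ 2)%:E)%E.

Definition moreau_env (g : E -> \bar R) (alpha : R) (x : E) : \bar R :=
  ereal_inf (range (prox_obj g alpha x)).

(* A minimizer is a point at which the infimum is attained with a finite
   value: when the infimum of [F] is +oo (so that every point would attain it)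
   or -oo, there is no minimizer. *)
Definition argmin (F : E -> \bar R) : set E :=
  [set y | F y \is a fin_num /\ forall z, (F y <= F z)%E].

Definition prox (g : E -> \bar R) (alpha : R) (x : E) : set E :=
  argmin (prox_obj g alpha x).

End MoreauEnvelope.

Section DotProduct.
Context {R : realType} {n : nat}.

Definition dotprod (x y : 'rV[R]_n) : R := \sum_(i < n) x 0 i * y 0 i.

Let dotprodC (x y : 'rV[R]_n) :
  dotprod x y = (-1) ^+ false * idfun (dotprod y x).
Proof. by rewrite expr0 mul1r; apply: eq_bigr => i _; rewrite mulrC. Qed.

Let dotprod_bilinear : bilinear_for *%R (idfun \; *%R) dotprod.
Proof.
split=> z a x y; rewrite /dotprod /= mulr_sumr -big_split;
  apply: eq_bigr => i _; rewrite !mxE /=.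
  by rewrite mulrDl mulrA.
by rewrite mulrDr mulrCA.
Qed.

HB.instance Definition _ := bilinear_isBilinear.Build R _ _ R
  *%R (idfun \; *%R) dotprod dotprod_bilinear.
HB.instance Definition _ :=
  isHermitianSesquilinear.Build R _ false idfun dotprod dotprodC.

Let dotprod_gt0 (x : 'rV[R]_n) : x != 0 -> 0 < dotprod x x.
Proof.
move=> x0; rewrite lt0r sumr_ge0 ?andbT => [|i _]; last exact: sqr_ge0.
apply: contra x0; rewrite psumr_eq0 => [/allP xx|i _]; last exact: sqr_ge0.
apply/eqP/rowP => i; rewrite mxE; apply/eqP.
by have := xx i (mem_index_enum i); rewrite -expr2 sqrf_eq0.
Qed.

HB.instance Definition _ := isDotProduct.Build R _ dotprod dotprod_gt0.

End DotProduct.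

Section SymmetricMatrices.
Context (R : realType) (n : nat).

Record symmx := SymMx {
  mx_of_symmx :> 'M[R]_n ;
  _ : mx_of_symmx \is symmetricmx }.

HB.instance Definition _ := [isSub for mx_of_symmx].
HB.instance Definition _ := [Choice of symmx by <:].

Lemma symmetricmxE (X : 'M[R]_n) : (X \is symmetricmx) = (X == X^T).
Proof. by rewrite is_hermitianmxE expr0 scale1r map_mx_id. Qed.

Let symmetricmx_submod :
  submod_closed (fun X : 'M[R]_n => X \is symmetricmx).
Proof.
split=> [|a X Y]; rewrite -!topredE /= !symmetricmxE ?trmx0 //.
by move=> /eqP XT /eqP YT; rewrite linearP /= -XT -YT.
Qed.

HB.instance Definition _ := GRing.SubChoice_isSubLmodule.Build R 'M[R]_n
  (fun X => X \is symmetricmx) symmx symmetricmx_submod.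

End SymmetricMatrices.

Section TraceInnerProduct.
Context {R : realType} {n : nat}.
Local Notation symmx := (symmx R n).

Definition trprod (X Y : symmx) : R :=
  \tr ((X : 'M[R]_n) *m (Y : 'M[R]_n)).

Let trprodC (X Y : symmx) : trprod X Y = (-1) ^+ false * idfun (trprod Y X).
Proof. by rewrite expr0 mul1r /trprod mxtrace_mulC. Qed.

Let trprod_bilinear : bilinear_for *%R (idfun \; *%R) trprod.
Proof.
split=> Z a X Y; rewrite /trprod /=.
  by rewrite mulmxDl -scalemxAl mxtraceD mxtraceZ.
by rewrite mulmxDr -scalemxAr mxtraceD mxtraceZ.
Qed.

HB.instance Definition _ := bilinear_isBilinear.Build R _ _ R
  *%R (idfun \; *%R) trprod trprod_bilinear.
HB.instance Definition _ :=
  isHermitianSesquilinear.Build R _ false idfun trprod trprodC.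

Let trprod_gt0 (X : symmx) : X != 0 -> 0 < trprod X X.
Proof.
move=> X0; have XT : X = (X : 'M[R]_n)^T :> 'M[R]_n.
  by apply/eqP; rewrite -symmetricmxE; exact: (valP X).
have trE : trprod X X = \sum_i \sum_j (X : 'M[R]_n) i j ^+ 2.
  rewrite /trprod {2}XT; apply: eq_bigr => i _; rewrite mxE.
  by apply: eq_bigr => j _; rewrite mxE.
have s0 i : 0 <= \sum_j (X : 'M[R]_n) i j ^+ 2.
  by apply: sumr_ge0 => j _; exact: sqr_ge0.
rewrite trE lt0r sumr_ge0 ?andbT => [|i _]; last exact: s0.
apply: contra X0; rewrite psumr_eq0 => [/allP Xi|i _]; last exact: s0.
apply/eqP/val_inj/matrixP => i j; rewrite [RHS]mxE; apply/eqP.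
have := Xi i (mem_index_enum i); rewrite psumr_eq0 => [/allP Xij|k _].
  by have := Xij j (mem_index_enum j); rewrite sqrf_eq0.
exact: sqr_ge0.
Qed.

HB.instance Definition _ := isDotProduct.Build R _ trprod trprod_gt0.

End TraceInnerProduct.

Section Spectral.
Context {R : realType} {n : nat}.

(* The set below has exactly one element: by the spectral theorem the
   characteristic polynomial of a real symmetric matrix splits over [R], and
   ordering its roots (repeated according to multiplicity) determines the
   vector. *)
Definition lambda (X : symmx R n) : 'rV[R]_n :=
  xget 0 [set x : 'rV[R]_n |
    (forall i j : 'I_n, (i <= j)%N -> x 0 j <= x 0 i) /\
    char_poly X = \prod_(i < n) ('X - (x 0 i)%:P)].

Definition orthogonal_group : set 'M[R]_n := [set U | U *m U^T = 1%:M].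

Definition orthogonal_diag (X : symmx R n) : set 'M[R]_n :=
  [set U | orthogonal_group U /\ U *m diag_mx (lambda X) *m U^T = X].

Definition symmetric_fun (f : 'rV[R]_n -> \bar R) : Prop :=
  forall (s : 'S_n) (x : 'rV[R]_n), f (\row_i x 0 (s i)) = f x.

Definition simultaneous_ordered_spectral_decomposition (X Y : symmx R n) :=
  exists U : 'M[R]_n,
    [/\ orthogonal_group U,
        U *m X *m U^T = diag_mx (lambda X) &
        U *m Y *m U^T = diag_mx (lambda Y)].

End Spectral.

(* Main.v *)
(* Every orbit matrix [U Diag(y) U^T] with [U] in [O_X] is at the same distance
   from [X] as [y] is from [lambda X], while von Neumann's trace inequality
   [tr(XY) <= <lambda X, lambda Y>] gives [|Y - X| >= |lambda Y - lambda X|]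
   in general; so the two infima agree, and a minimizer [Y] is exactly one with
   [lambda Y] a minimizer and equality in the trace inequality.  In the
   equality case [lambda (X + Y) = lambda X + lambda Y]; if [U] diagonalizes
   [X + Y], then comparing [X] with [U Diag(lambda X) U^T] and with
   [U Diag(lambda Y) U^T] through the trace inequality forces
   [X = U Diag(lambda X) U^T], hence also [Y = U Diag(lambda Y) U^T]. *)
Require Import Defs.
From HB Require Import structures.
From mathcomp Require Import all_boot all_order all_algebra all_fingroup.
From mathcomp Require Import sesquilinear spectral complex ring lra.
From mathcomp Require Import boolp classical_sets reals constructive_ereal ereal.

Set Implicit Arguments.
Unset Strict Implicit.
Unset Printing Implicit Defensive.

Import Order.TTheory GRing.Theory Num.Theory.

Local Open Scope classical_set_scope.
Local Open Scope ring_scope.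

(** * Spectral theorem for real symmetric matrices *)

Lemma symmetric_eigenvector (R : realType) n (A : 'M[R]_n.+1) : A^T = A ->
  exists a, exists2 v : 'rV_n.+1, v *m A = a *: v & v != 0.
Proof.
(* Complexified, [A] is Hermitian, hence unitarily diagonalizable with a real diagonal; the first
   diagonal entry [a] is the eigenvalue sought. *)
move=> A_sym; pose Ac := map_mx (real_complex R) A.
have Ac_herm : Ac \is hermsymmx.
  apply: realsym_hermsym.
    by apply/is_hermitianmxP; rewrite expr0 scale1r map_mx_id // map_trmx A_sym.
  by apply/mxOverP => i j; rewrite mxE complex_real.
have /orthomx_spectralP AcE := hermitian_normalmx Ac_herm.
have /mxOverP/(_ 0 0) := hermitian_spectral_diag_real Ac_herm.
set P := spectralmx Ac in AcE; set d := spectral_diag Ac in AcE *.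
have P_unit : P \in unitmx := spectral_unit Ac.
case dE : (d 0 0) => [a b] d_real; have b0 : b = 0.
  by move: d_real => /CrealP/eqP; rewrite eq_complex /= => /andP[_ /eqP]; lra.
have eig : eigenvalue Ac (real_complex R a).
  apply/eigenvalueP; exists (row 0 P); last first.
    apply: contraTneq P_unit => /(congr1 (mulmx^~ (invmx P))) r0.
    apply/negP => Pu; move: r0; rewrite mul0mx -row_mul mulmxV // => /rowP/(_ 0).
    by rewrite !mxE => /eqP; rewrite oner_eq0.
  rewrite -row_mul AcE !mulmxA mulmxV // mul1mx mul_diag_mx.
  by apply/rowP => j; rewrite !mxE dE b0.
(* The characteristic polynomial of [Ac] is the image of that of [A], so [a] is already a root over
   [R] and has a real eigenvector. *)
exists a; apply/eigenvalueP; move: eig.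
by rewrite !eigenvalue_root_char -map_char_poly fmorph_root.
Qed.

Lemma mulmx_trE (R : comNzRingType) n (x y : 'rV[R]_n) :
  x *m y^T = (\sum_i x 0 i * y 0 i)%:M.
Proof.
by apply/rowP => i; rewrite !ord1 !mxE mulr1n; apply: eq_bigr => j _; rewrite !mxE.
Qed.

(** [H] is the reflection along [w = e - u], which exchanges the first basis vector [e] and the
    normalized vector [u]; it is symmetric and an involution, hence orthogonal. It serves to move an
    eigenvector onto the first axis. *)
Lemma householder (R : rcfType) n (v : 'rV[R]_n.+1) : v != 0 ->
  exists H : 'M[R]_n.+1, H *m H^T = 1%:M /\ exists c, row 0 H = c *: v.
Proof.
move=> v0; pose c := Num.sqrt (\sum_i v 0 i * v 0 i).
have c_gt0 : 0 < c.
  rewrite sqrtr_gt0 lt0r sumr_ge0 ?andbT => [|i _]; last exact: sqr_ge0.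
  apply: contra v0; rewrite psumr_eq0 => [/allP vv|i _]; last exact: sqr_ge0.
  apply/eqP/rowP => i; rewrite mxE; apply/eqP.
  by have := vv i (mem_index_enum i); rewrite -expr2 sqrf_eq0.
pose u := c^-1 *: v; pose e : 'rV[R]_n.+1 := delta_mx 0 0.
have [w wE] : exists w, w = e - u by exists (e - u).
have uu : u *m u^T = 1%:M.
  rewrite linearZ /= -scalemxAl -scalemxAr mulmx_trE scalerA scale_scalar_mx.
  have -> : \sum_i v 0 i * v 0 i = c * c.
    by rewrite -expr2 sqr_sqrtr // sumr_ge0 // => i _; rewrite -expr2 sqr_ge0.
  by congr (_%:M); field; rewrite gt_eqF.
have ee : e *m e^T = 1%:M.
  by rewrite trmx_delta mul_delta_mx; apply/rowP => i; rewrite !ord1 !mxE.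
have eu : e *m u^T = (u 0 0)%:M.
  by rewrite -rowE; apply/rowP => i; rewrite !ord1 !mxE.
have ue : u *m e^T = (u 0 0)%:M.
  by apply: trmx_inj; rewrite trmx_mul trmxK eu tr_scalar_mx.
(* As [e] and [u] are unit vectors, [s] is the squared norm of [w]. *)
pose s := 2 * (1 - u 0 0); have ww : w *m w^T = s%:M.
  rewrite wE linearB /= mulmxBr !mulmxBl uu ee eu ue -!raddfB /=.
  by congr (_%:M); rewrite /s; ring.
have w0 : s = 0 -> w = 0.
  move=> s0; apply/rowP => i; rewrite [RHS]mxE; apply/eqP.
  move: ww; rewrite mulmx_trE s0 => /rowP/(_ 0)/eqP; rewrite [X in X == _]mxE.
  rewrite [X in _ == X]mxE /= mulr1n mul0rn psumr_eq0 => [/allP ww|j _].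
    by have := ww i (mem_index_enum i); rewrite -expr2 sqrf_eq0.
  exact: sqr_ge0.
(* If [v] is already along the first axis, then [w = 0] and [H = 1], whatever
   the junk value of [2 / 0]. *)
pose H := 1%:M - (2 / s) *: (w^T *m w).
have HT : H^T = H.
  by rewrite /H linearB linearZ /= trmx1 trmx_mul trmxK.
exists H; split.
  rewrite HT; have [s0|s0] := eqVneq s 0.
    by rewrite /H w0 // mulmx0 scaler0 subr0 mulmx1.
  rewrite {1}/H mulmxBl mul1mx -scalemxAl /H mulmxBr mulmx1 -scalemxAr.
  rewrite -mulmxA [w *m _]mulmxA ww mul_scalar_mx -scalemxAr scalerA.
  rewrite divfK // scalerBr scalerA -addrA -opprD addrA -scalerDl -scalerBl.
  set a : R := (_ - _); have -> : a = 0 by rewrite /a; ring.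
  by rewrite scale0r subr0.
(* The first row of [H] is [e - (2 / s) (e . w) w]; since [e . w = 1 - u 0 0] is half of [s], this
   is [e - w = u]. *)
exists c^-1; rewrite rowE -/e -/u /H mulmxBr mulmx1 -scalemxAr mulmxA.
rewrite {1}wE linearB /= mulmxBr ee eu -raddfB /= mul_scalar_mx scalerA.
have [s0|s0] := eqVneq s 0.
  by rewrite w0 // scaler0 subr0; apply/eqP; rewrite -subr_eq0 -wE w0.
have -> : 2 / s * (1 - u 0 0) = 1.
  by rewrite mulrAC -/s divff.
by rewrite scale1r wE opprB addrC subrK.
Qed.

(** Deflation: conjugating by the reflection of an eigenvector makes the first row of [B] a multiple
    of the first basis vector, symmetry clears the first column too, and the induction hypothesis
    diagonalizes the remaining block. *)
Lemma spectral_theorem (R : realType) n (A : 'M[R]_n) : A^T = A ->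
  exists (U : 'M[R]_n) (d : 'rV[R]_n),
    U *m U^T = 1%:M /\ A = U *m diag_mx d *m U^T.
Proof.
elim: n A => [|n IHn] A A_sym.
  by exists 1%:M, 0; split; apply/matrixP => -[].
have [a [v vA v0]] := symmetric_eigenvector A_sym.
have [H [HHT [c rowH]]] := householder v0.
have HTH : H^T *m H = 1%:M := mulmx1C HHT.
pose B : 'M[R]_(1 + n) := H *m A *m H^T.
have B_sym : B^T = B by rewrite /B !trmx_mul trmxK A_sym mulmxA.
have rowB : row 0 B = a *: row 0 (1%:M : 'M_(1 + n)).
  rewrite /B !row_mul rowH -scalemxAl vA scalerA mulrC -scalerA -rowH.
  by rewrite -scalemxAl -row_mul HHT.
have [V [d [VVT drE]]] : exists (V : 'M[R]_n) (d : 'rV[R]_n),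
    V *m V^T = 1%:M /\ drsubmx B = V *m diag_mx d *m V^T.
  by apply: IHn; rewrite trmx_drsub B_sym.
have urB : ursubmx B = 0.
  apply/matrixP => i j; rewrite ord1 !mxE.
  have /rowP/(_ (rshift 1 j)) := rowB; rewrite !mxE.
  suff -> : lshift n (0 : 'I_1) = 0 by move->; rewrite mulr0.
  exact: val_inj.
have ulB : ulsubmx B = a%:M.
  apply/matrixP => i j; rewrite !ord1 !mxE.
  have /rowP/(_ 0) := rowB; rewrite !mxE mulr1.
  suff -> : lshift n (0 : 'I_1) = 0 by move->.
  exact: val_inj.
have dlB : dlsubmx B = 0 by rewrite -[LHS]trmxK trmx_dlsub B_sym urB trmx0.
pose W : 'M[R]_(1 + n) := block_mx 1%:M 0 0 V.
have WT : W^T = block_mx 1%:M 0 0 V^T by rewrite tr_block_mx trmx1 !trmx0.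
have WWT : W *m W^T = 1%:M.
  rewrite WT mulmx_block !(mul0mx, mulmx0, mulmx1, mul1mx, add0r, addr0) VVT.
  by rewrite -scalar_mx_block.
have BE : B = W *m diag_mx (row_mx a%:M d) *m W^T.
  rewrite WT diag_mx_row !mulmx_block !(mul0mx, mulmx0, mulmx1, mul1mx, add0r, addr0).
  rewrite -drE -{1}[B]submxK urB ulB dlB; congr block_mx.
  by apply/matrixP => i j; rewrite !ord1 !mxE.
exists (H^T *m W), (row_mx a%:M d); split.
  by rewrite trmx_mul trmxK mulmxA -[_ *m W *m _]mulmxA WWT mulmx1.
have -> : A = H^T *m B *m H by rewrite /B !mulmxA HTH mul1mx -mulmxA HTH mulmx1.
by rewrite BE trmx_mul trmxK !mulmxA.
Qed.

(** * Ordered eigenvalues and diagonal conjugates *)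

Definition nonincreasing_row (R : realType) n (x : 'rV[R]_n) :=
  forall i j : 'I_n, (i <= j)%N -> x 0 j <= x 0 i.

Lemma sort_row (R : realType) n (x : 'rV[R]_n) :
  exists s : 'S_n, nonincreasing_row (\row_i x 0 (s i)).
Proof.
pose t := [tuple x 0 i | i < n].
have : perm_eq (sort >=%R t) t by rewrite perm_sort.
case/tuple_permP => s sE; exists s => i j ij; rewrite !mxE.
have t_sorted : sorted >=%R (sort >=%R t).
  by apply: sort_sorted => a b; rewrite orbC le_total.
have sz : size (sort >=%R t) = n by rewrite size_sort size_tuple.
have nthE (k : 'I_n) : nth 0 (sort >=%R t) k = x 0 (s k).
  by rewrite sE (nth_map k) ?size_enum_ord // nth_ord_enum tnth_mktuple.
have ge_tr : transitive (>=%R : rel R) by move=> a b c ba cb; apply: le_trans cb ba.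
have ge_refl : reflexive (>=%R : rel R) by move=> a; apply: lexx.
by rewrite -!nthE; apply: (sorted_leq_nth ge_tr ge_refl 0 t_sorted);
  rewrite ?inE ?sz.
Qed.

(** A split monic polynomial determines the multiset of its roots, and a multiset has a single
    nonincreasing arrangement. This gives the uniqueness behind [lambda]. *)
Lemma nonincreasing_row_perm (R : realType) n (x y : 'rV[R]_n) :
  nonincreasing_row x -> nonincreasing_row y ->
  \prod_i ('X - (x 0 i)%:P) = \prod_i ('X - (y 0 i)%:P) -> x = y.
Proof.
move=> x_dec y_dec xy.
pose t (z : 'rV[R]_n) := [seq z 0 i | i <- enum 'I_n].
have tP (z : 'rV[R]_n) : \prod_i ('X - (z 0 i)%:P) = \prod_(a <- t z) ('X - a%:P).
  by rewrite big_map big_enum.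
have t_nth (z : 'rV[R]_n) (i : 'I_n) : nth 0 (t z) i = z 0 i.
  by rewrite (nth_map i) ?size_enum_ord // nth_ord_enum.
have t_sorted z : nonincreasing_row z -> sorted >=%R (t z).
  move=> z_dec; apply/(sortedP 0) => i; rewrite size_map size_enum_ord => i1n.
  have := z_dec (Ordinal (ltnW i1n)) (Ordinal i1n) (leqnSn i).
  by rewrite -!t_nth.
have txy : t x = t y.
  apply: (sorted_eq (leT := >=%R)); [| |exact: t_sorted|exact: t_sorted|].
  - by move=> a b c ba cb; apply: le_trans cb ba.
  - by move=> a b /= ab; apply: le_anti; rewrite andbC.
  - by apply: prod_XsubC_eq; rewrite -!tP.
by apply/rowP => i; rewrite -!t_nth txy.
Qed.

(** Over the polynomial ring the characteristic matrix is itself conjugated by [U], and the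
    determinants of [U] and [U^T] cancel. *)
Lemma char_poly_conj_diag (R : comNzRingType) n (U : 'M[R]_n) (y : 'rV[R]_n) :
  U *m U^T = 1%:M ->
  char_poly (U *m diag_mx y *m U^T) = \prod_i ('X - (y 0 i)%:P).
Proof.
move=> UUT; pose Up := map_mx polyC U.
have UpUpT : Up *m Up^T = 1%:M by rewrite map_trmx -map_mxM UUT map_mx1.
rewrite /char_poly.
have -> : char_poly_mx (U *m diag_mx y *m U^T) =
    Up *m char_poly_mx (diag_mx y) *m Up^T.
  rewrite /char_poly_mx mulmxBr mulmxBl mul_mx_scalar -scalemxAl UpUpT.
  by rewrite scalemx1 !map_mxM map_trmx.
rewrite !det_mulmx mulrAC -det_mulmx UpUpT det1 mul1r.
rewrite -/(char_poly _) char_poly_trig ?diag_mx_is_trig //.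
by apply: eq_bigr => i _; rewrite !mxE eqxx mulr1n.
Qed.

Lemma diag_mx_perm (R : pzRingType) n (s : 'S_n) (y : 'rV[R]_n) :
  diag_mx (\row_i y 0 (s i)) = perm_mx s *m diag_mx y *m (perm_mx s)^T.
Proof.
rewrite -row_permE tr_perm_mx -[X in X *m _]/(row_perm s _) -col_permE.
by apply/matrixP => i j; rewrite !mxE (inj_eq perm_inj).
Qed.

Section Lambda.
Variables (R : realType) (n : nat).
Implicit Types (X Y : symmx R n) (x y : 'rV[R]_n) (U : 'M[R]_n).

Lemma symmx_tr X : (X : 'M[R]_n)^T = X.
Proof. by apply/esym/eqP; rewrite -symmetricmxE; exact: (valP X). Qed.

Lemma conj_diag_symmetric U y : U *m diag_mx y *m U^T \is symmetricmx.
Proof. by rewrite symmetricmxE !trmx_mul trmxK tr_diag_mx mulmxA. Qed.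

Definition conj_diag U y : symmx R n := SymMx (conj_diag_symmetric U y).

Lemma lambda_unique X x : nonincreasing_row x ->
  char_poly X = \prod_i ('X - (x 0 i)%:P) -> lambda X = x.
Proof.
(* The default value of [xget] is ruled out because [x] itself lies in the set. *)
move=> x_dec xP; rewrite /lambda; case: xgetP => [z _ [z_dec zP]|/(_ x)].
  by apply: nonincreasing_row_perm => //; rewrite -zP -xP.
by case.
Qed.

Lemma lambda_sorted X x U : nonincreasing_row x -> orthogonal_group U ->
  X = U *m diag_mx x *m U^T :> 'M[R]_n -> lambda X = x.
Proof.
by move=> x_dec UUT XE; apply: lambda_unique => //; rewrite XE char_poly_conj_diag.
Qed.

(** Sort [y] by a permutation and absorb the permutation matrix into [U]: any diagonalization
    becomes an ordered one. *)
Lemma lambda_conj_diag X U y : orthogonal_group U ->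
  X = U *m diag_mx y *m U^T :> 'M[R]_n ->
  exists s : 'S_n, [/\ lambda X = \row_i y 0 (s i), nonincreasing_row (lambda X)
    & orthogonal_diag X (U *m (perm_mx s)^T)].
Proof.
move=> UUT XE; have [s ys_dec] := sort_row y.
have PTP : (perm_mx s)^T *m perm_mx s = 1%:M :> 'M[R]_n.
  by rewrite tr_perm_mx -perm_mxM mulVg perm_mx1.
have V_orth : orthogonal_group (U *m (perm_mx s)^T).
  rewrite /orthogonal_group /= trmx_mul trmxK mulmxA.
  by rewrite -[U *m _ *m _]mulmxA PTP mulmx1.
have XE' : X = U *m (perm_mx s)^T *m diag_mx (\row_i y 0 (s i)) *m
    (U *m (perm_mx s)^T)^T :> 'M[R]_n.
  rewrite diag_mx_perm trmx_mul trmxK !mulmxA -[U *m _ *m _]mulmxA PTP mulmx1.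
  by rewrite -(mulmxA _ (perm_mx s)^T) PTP mulmx1.
have lE := lambda_sorted ys_dec V_orth XE'.
by exists s; split; rewrite ?lE //; split; rewrite // lE -XE'.
Qed.

Lemma orthogonal_diag_ex X :
  nonincreasing_row (lambda X) /\ exists U, orthogonal_diag X U.
Proof.
have [U [d [UUT XE]]] := spectral_theorem (symmx_tr X).
by have [s [_ ? ?]] := lambda_conj_diag UUT XE; split=> //; eexists; eassumption.
Qed.

End Lambda.

(** * Rearrangement inequality for doubly stochastic matrices *)

Lemma abel_ge (R : realType) n (y d : 'I_n.+1 -> R) :
  (forall i j : 'I_n.+1, (i <= j)%N -> y j <= y i) ->
  (forall m, 0 <= \sum_(i < n.+1 | (i < m)%N) d i) ->
  y ord_max * \sum_i d i <= \sum_i y i * d i.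
Proof.
elim: n y d => [|n IHn] y d y_dec d_ge0.
  by rewrite !big_ord1 (ord1 ord_max).
pose w (i : 'I_n.+1) := widen_ord (leqnSn n.+1) i.
have dw_ge0 m : 0 <= \sum_(i < n.+1 | (i < m)%N) d (w i).
  have := d_ge0 (minn m n.+1); rewrite big_mkcond big_ord_recr /=.
  rewrite [X in _ + X]ifF ?addr0; last by rewrite leq_min ltnn andbF.
  rewrite -big_mkcond /=; congr (0 <= _); apply: eq_bigl => i.
  by rewrite leq_min ltn_ord andbT.
have := IHn (y \o w) (d \o w) _ dw_ge0.
rewrite [X in y ord_max * X]big_ord_recr [X in _ -> _ <= X]big_ord_recr /= => IH.
rewrite mulrDr lerD2r; apply: le_trans (IH _); last first.
  by move=> i j ij; apply: y_dec.
(* Summation by parts: the partial sum of [d] without its last term is nonnegative, so its factor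
   may be lowered from the second to last value of [y] to the last one. *)
apply: ler_wpM2r; last exact: y_dec.
by have := dw_ge0 n.+1; congr (0 <= _); apply: eq_bigl => i; rewrite ltn_ord.
Qed.

(** The vector [x] majorizes its average [x S]: the difference [d] has nonnegative partial sums and
    total 0. Summation by parts against the nonincreasing [y] then gives the inequality. *)
Lemma doubly_stochastic_rearrangement (R : realType) n (S : 'M[R]_n)
    (x y : 'rV[R]_n) :
  nonincreasing_row x -> nonincreasing_row y ->
  (forall i j, 0 <= S i j) ->
  (forall i, \sum_j S i j = 1) -> (forall j, \sum_i S i j = 1) ->
  \sum_i \sum_j x 0 i * S i j * y 0 j <= \sum_i x 0 i * y 0 i.
Proof.
case: n S x y => [|n] S x y x_dec y_dec S_ge0 Srow Scol; first by rewrite !big_ord0.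
pose d j := x 0 j - \sum_i x 0 i * S i j.
have sd : \sum_j d j = 0.
  rewrite /d sumrB exchange_big /=; apply/eqP; rewrite subr_eq0; apply/eqP.
  by apply: eq_bigr => i _; rewrite -mulr_sumr Srow mulr1.
suff : 0 <= \sum_j y 0 j * d j.
  under eq_bigr do rewrite /d mulrBr mulr_sumr.
  rewrite sumrB subr_ge0 exchange_big /=.
  under [X in X <= _]eq_bigr do under eq_bigr do rewrite mulrC.
  by under [X in _ <= X]eq_bigr do rewrite mulrC.
have := @abel_ge _ _ (y 0) d y_dec; rewrite sd mulr0; apply=> m.
(* [c i] is the mass that row [i] puts on the first [m] columns; row sums place it in [0, 1], and
   column sums make the total of the [c i] equal to the number of those columns. *)
pose c i := \sum_(j < n.+1 | (j < m)%N) S i j.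
(* The weights [(i < m)%:R - c i] sum to zero and change sign after index
   [m - 1], so [x] may be shifted by its value [p] there. *)
pose p := x 0 (inord (minn m.-1 n)).
(* The truncations cover [m = 0] and [m] beyond the length, where only one of the two signs
   occurs. *)
have kE : nat_of_ord (inord (minn m.-1 n) : 'I_n.+1) = minn m.-1 n.
  by rewrite inordK // ltnS geq_minr.
have c_ge0 i : 0 <= c i by apply: sumr_ge0.
have c_le1 i : c i <= 1.
  by rewrite -(Srow i) /c big_mkcond ler_sum // => j _; case: ifP.
have -> : \sum_(j < n.+1 | (j < m)%N) d j =
    \sum_(i < n.+1) ((i < m)%N%:R - c i) * (x 0 i - p).
  have c_sum : \sum_(i < n.+1) ((i < m)%N%:R - c i) = 0.
    rewrite sumrB /c exchange_big /= [X in _ - X]big_mkcond -sumrB.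
    by apply: big1 => j _; rewrite Scol; case: ifP; rewrite subrr.
  under [RHS]eq_bigr do rewrite mulrBr.
  rewrite [RHS]sumrB -[X in _ = _ - X]mulr_suml c_sum mul0r subr0.
  under [RHS]eq_bigr do rewrite mulrBl.
  rewrite /d !sumrB; congr (_ - _).
    rewrite big_mkcond; apply: eq_bigr => i _.
    by case: ifP => _; rewrite ?mul1r ?mul0r.
  rewrite exchange_big /=; apply: eq_bigr => i _.
  by rewrite /c mulr_suml; apply: eq_bigr => j _; rewrite mulrC.
(* Both factors are nonnegative before index [m] and nonpositive from [m] on. *)
apply: sumr_ge0 => i _; have [im|mi] := ltnP i m.
  rewrite mulr_ge0 ?subr_ge0 //; apply: x_dec; rewrite kE leq_min -ltnS.
  by rewrite (ltn_predK im) im -ltnS ltn_ord.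
rewrite sub0r mulNr -mulrN opprB mulr_ge0 ?subr_ge0 //; apply: x_dec.
by rewrite kE geq_min (leq_trans (leq_pred m)).
Qed.

(** * Real inner products and equality criteria *)

Section RealDotProduct.
Variables (R : realType) (E : lmodType R) (dot : {dot E for idfun}).
Implicit Types u v w : E.

Lemma dotC u v : dot u v = dot v u.
Proof. by rewrite hermC /= expr0 mul1r. Qed.

Lemma dotDr u v w : dot u (v + w) = dot u v + dot u w.
Proof. exact: linearDr. Qed.

Lemma dotDl u v w : dot (u + v) w = dot u w + dot v w.
Proof. by rewrite dotC dotDr !(dotC w). Qed.

Lemma dotBB u v : dot (u - v) (u - v) = dot u u + dot v v - 2 * dot u v.
Proof. by rewrite linearBl !linearBr /= (dotC v u); ring. Qed.

Lemma dot_ge0 u : 0 <= dot u u.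
Proof.
have [->|u0] := eqVneq u 0; first by rewrite linear0l.
exact/ltW/neq0_dnorm_gt0.
Qed.

(** The hypothesis bounds the squared norm of [u - v] by 0. Every equality case below is settled by
    this test. *)
Lemma dotBB_le0 u v : dot u u + dot v v <= 2 * dot u v -> u = v.
Proof.
rewrite -subr_le0 -dotBB => uv; apply/eqP; rewrite -subr_eq0; apply: contraLR uv.
by move=> /(@neq0_dnorm_gt0 _ _ _ dot); rewrite ltNge.
Qed.

Lemma enormB_sqr u v : enorm dot (u - v) ^+ 2 = dot u u + dot v v - 2 * dot u v.
Proof. by rewrite /enorm sqr_sqrtr ?dot_ge0 // dotBB. Qed.

End RealDotProduct.

(** Meant for two matrices [u], [v] with spectra [x], [y], and [z] the spectrum of [u + v]. Both [z]
    and [x + y] have the norm of [u + v], and adding the last two bounds shows that their product is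
    at least its square, so they coincide. *)
Lemma dot_sum_majorant (R : realType) (E F : lmodType R) (dotE : {dot E for idfun})
    (dotF : {dot F for idfun}) (u v : E) (x y z : F) :
  dotE u u = dotF x x -> dotE v v = dotF y y -> dotE u v = dotF x y ->
  dotE (u + v) (u + v) = dotF z z ->
  dotE u (u + v) <= dotF x z -> dotE v (u + v) <= dotF y z -> z = x + y.
Proof.
move=> uu vv uv ww uz vz; apply/esym/(@dotBB_le0 _ _ dotF).
rewrite -ww !dotDl; move: uz vz; rewrite !dotDr (dotC dotE v u) (dotC dotF y x) uu vv uv.
lra.
Qed.

(** * Von Neumann's trace inequality and its equality case *)

Section TraceInequality.
Variables (R : realType) (n : nat).
Implicit Types (X Y Z : symmx R n) (x y z : 'rV[R]_n) (U : 'M[R]_n).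

Lemma trprodC X Y : trprod X Y = trprod Y X.
Proof. exact: (dotC trprod). Qed.

Lemma trprodDr X Y Z : trprod X (Y + Z) = trprod X Y + trprod X Z.
Proof. exact: (dotDr trprod). Qed.

Lemma trprod_conj_diag U x y : orthogonal_group U ->
  trprod (conj_diag U x) (conj_diag U y) = dotprod x y.
Proof.
move=> UUT; have UTU : U^T *m U = 1%:M := mulmx1C UUT.
rewrite /trprod /= mulmxA mxtrace_mulC !mulmxA UTU mul1mx.
rewrite -[_ *m U^T *m U]mulmxA UTU mulmx1 mulmx_diag mxtrace_diag.
by apply: eq_bigr => i _; rewrite mxE.
Qed.

Lemma orthogonal_diag_conj X U : orthogonal_diag X U ->
  orthogonal_group U /\ X = conj_diag U (lambda X).
Proof. by case=> UUT XE; split=> //; apply: val_inj. Qed.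

(** In eigenbases of [X] and [Y] the trace is a bilinear form in the two spectra, with coefficients
    the squared entries of the orthogonal matrix [W = U^T V]; these form a doubly stochastic
    matrix. *)
Lemma trprod_le_dotprod_lambda X Y : trprod X Y <= dotprod (lambda X) (lambda Y).
Proof.
have [x_dec [U /orthogonal_diag_conj[UUT XE]]] := orthogonal_diag_ex X.
have [y_dec [V /orthogonal_diag_conj[VVT YE]]] := orthogonal_diag_ex Y.
set x := lambda X in x_dec XE *; set y := lambda Y in y_dec YE *.
have UTU : U^T *m U = 1%:M := mulmx1C UUT.
have VTV : V^T *m V = 1%:M := mulmx1C VVT.
pose W := U^T *m V.
have WWT : W *m W^T = 1%:M.
  by rewrite trmx_mul trmxK mulmxA -[U^T *m V *m _]mulmxA VVT mulmx1.
have WTW : W^T *m W = 1%:M := mulmx1C WWT.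
pose S := \matrix_(i, j) W i j ^+ 2.
have -> : trprod X Y = \sum_i \sum_j x 0 i * S i j * y 0 j.
  rewrite /trprod XE YE /= mulmxA mxtrace_mulC.
  have -> : V^T *m (U *m diag_mx x *m U^T *m (V *m diag_mx y)) =
      W^T *m (diag_mx x *m W *m diag_mx y).
    by rewrite /W trmx_mul trmxK !mulmxA.
  rewrite mxtrace_mulC; apply: eq_bigr => i _; rewrite !mxE.
  apply: eq_bigr => j _; rewrite mul_diag_mx mul_mx_diag !mxE.
  by ring.
apply: doubly_stochastic_rearrangement => // [i j|i|j].
- by rewrite mxE sqr_ge0.
- move: WWT => /matrixP/(_ i i); rewrite [RHS]mxE eqxx mulr1n => <-.
  by rewrite mxE; apply: eq_bigr => j _; rewrite !mxE.
- move: WTW => /matrixP/(_ j j); rewrite [RHS]mxE eqxx mulr1n => <-.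
  by rewrite mxE; apply: eq_bigr => i _; rewrite !mxE.
Qed.

Lemma trprod_lambda X : trprod X X = dotprod (lambda X) (lambda X).
Proof.
have [_ [U /orthogonal_diag_conj[UUT XE]]] := orthogonal_diag_ex X.
by rewrite {1 2}XE trprod_conj_diag.
Qed.

Lemma trprod_conj_diag_le X U x : orthogonal_group U -> nonincreasing_row x ->
  trprod X (conj_diag U x) <= dotprod (lambda X) x.
Proof.
move=> UUT x_dec; rewrite -[in leRHS](@lambda_sorted _ _ (conj_diag U x) x U) //.
exact: trprod_le_dotprod_lambda.
Qed.

Lemma conj_diagD U x y : conj_diag U (x + y) = conj_diag U x + conj_diag U y.
Proof.
by apply: val_inj; rewrite /= raddfD /= mulmxDr mulmxDl.
Qed.

Lemma trprod_eq_dotprod_lambda X Y :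
  trprod X Y = dotprod (lambda X) (lambda Y) ->
  exists U, [/\ orthogonal_group U, X = conj_diag U (lambda X)
    & Y = conj_diag U (lambda Y)].
Proof.
have [x_dec _] := orthogonal_diag_ex X; have [y_dec _] := orthogonal_diag_ex Y.
have XX := trprod_lambda X; have YY := trprod_lambda Y.
have [_ [U /orthogonal_diag_conj[UUT ZE]]] := orthogonal_diag_ex (X + Y).
move=> XY; have zE : lambda (X + Y) = lambda X + lambda Y.
  apply: (@dot_sum_majorant _ _ _ trprod dotprod _ _ _ _ _ XX YY XY).
  - exact: trprod_lambda.
  - exact: trprod_le_dotprod_lambda.
  - exact: trprod_le_dotprod_lambda.
have XDx_le := trprod_conj_diag_le X UUT x_dec.
have XDy_le := trprod_conj_diag_le X UUT y_dec.
rewrite {}zE in ZE; move: (lambda X) (lambda Y) => x y in XX XY XDx_le XDy_le ZE *.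
rewrite conj_diagD in ZE.
(* The products of [X] with the two conjugates are bounded by [<x, x>] and [<x, y>], while their sum
   is [<X, X + Y> = <x, x> + <x, y>]; so both bounds are attained. *)
have XDx : trprod X (conj_diag U x) = dotprod x x.
  apply/eqP; rewrite eq_le XDx_le -(lerD2r (dotprod x y)) -{1}XX -{1}XY.
  by rewrite -!trprodDr ZE trprodDr lerD2l.
have XE : X = conj_diag U x.
  by apply: (@dotBB_le0 _ _ trprod); rewrite /= XX XDx trprod_conj_diag // mulr_natl.
exists U; split=> //; apply: (addrI X); rewrite ZE; congr (_ + _); exact: esym.
Qed.

End TraceInequality.

(** * Moreau envelope and proximal mapping of [f \o lambda] *)

Section SpectralFunctions.
Variables (R : realType) (n : nat) (f : 'rV[R]_n -> \bar R) (alpha : R).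
Hypotheses (f_symmetric : symmetric_fun f) (alpha_gt0 : 0 < alpha).
Implicit Types (X Y Z : symmx R n) (y z : 'rV[R]_n) (U : 'M[R]_n).

Let objS := prox_obj trprod (f \o lambda) alpha.
Let obj := prox_obj dotprod f alpha.

Lemma f_lambda_conj_diag U y : orthogonal_group U -> f (lambda (conj_diag U y)) = f y.
Proof.
move=> UUT; have [s [-> _ _]] := lambda_conj_diag UUT (erefl : conj_diag U y = _ :> 'M[R]_n).
exact: f_symmetric.
Qed.

Lemma prox_obj_conj_diag X U y : orthogonal_diag X U ->
  objS X (conj_diag U y) = obj (lambda X) y.
Proof.
case/orthogonal_diag_conj => UUT XE.
rewrite /objS /obj /prox_obj /= f_lambda_conj_diag // !enormB_sqr.
by rewrite /= (trprod_lambda X) [in trprod _ X]XE !trprod_conj_diag.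
Qed.

(** A symmetric matrix and its spectrum have equal norms, so the two squared distances differ only
    in the cross term, which the trace inequality controls. *)
Lemma prox_obj_lambda_le X Y : (obj (lambda X) (lambda Y) <= objS X Y)%E.
Proof.
rewrite /objS /obj /prox_obj /= leeD2l // lee_fin ler_pM2l ?invr_gt0 ?mulr_gt0 //.
rewrite !enormB_sqr /= !trprod_lambda lerD2l lerN2 ler_pM2l //.
exact: trprod_le_dotprod_lambda.
Qed.

Lemma moreau_env_lambda X :
  moreau_env trprod (f \o lambda) alpha X = moreau_env dotprod f alpha (lambda X).
Proof.
have [_ [U XU]] := orthogonal_diag_ex X.
apply/le_anti/andP; split; apply: le_ereal_inf_tmp => _ [z _ <-].
  by apply: ereal_inf_lbound; exists (conj_diag U z) => //; apply: prox_obj_conj_diag.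
apply: le_trans (prox_obj_lambda_le X z).
by apply: ereal_inf_lbound; exists (lambda z).
Qed.

Lemma prox_lambda_sub X Y : prox trprod (f \o lambda) alpha X Y ->
  prox dotprod f alpha (lambda X) (lambda Y) /\
  trprod Y X = dotprod (lambda Y) (lambda X).
Proof.
case=> Yfin Ymin; have [_ [U XU]] := orthogonal_diag_ex X.
(* Sandwich: [objS X Y] is at least [obj (lambda X) (lambda Y)], which is the value of [objS X] at
   [conj_diag U (lambda Y)] and so at least the minimum [objS X Y]. *)
have objE : obj (lambda X) (lambda Y) = objS X Y.
  apply/le_anti; rewrite prox_obj_lambda_le /= -(prox_obj_conj_diag _ XU).
  exact: Ymin.
split.
  split=> [|z]; first by rewrite -/obj objE.
  by rewrite -/obj objE -(prox_obj_conj_diag _ XU); apply: Ymin.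
(* Finiteness of the minimum allows cancelling [f (lambda Y)] from [objE]; the distances, and then
   the cross terms, must agree. *)
move: Yfin; rewrite fin_numD => /andP[fY _]; move: objE.
rewrite /objS /obj /prox_obj /= => /(congr1 (fun t => t - f (lambda Y))%E).
rewrite ![(f _ + _)%E]addeC !addeK // => -[/mulfI].
rewrite !enormB_sqr /= !trprod_lambda => /(_ _)/addrI/oppr_inj/mulfI.
move=> YX; apply/esym/YX => //.
by rewrite invr_eq0 mulf_neq0 // gt_eqF.
Qed.

Lemma prox_conj_diag X U y : orthogonal_diag X U ->
  prox dotprod f alpha (lambda X) y ->
  prox trprod (f \o lambda) alpha X (conj_diag U y).
Proof.
move=> XU [yfin ymin]; split=> [|Z]; rewrite -/objS prox_obj_conj_diag //.
exact: le_trans (ymin _) (prox_obj_lambda_le X Z).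
Qed.

End SpectralFunctions.

Theorem theorem4p1 (R : realType) (n : nat) (f : 'rV[R]_n -> \bar R)
    (alpha : R) (f_symmetric : symmetric_fun f) (alpha_gt0 : 0 < alpha) :
  [/\ moreau_env trprod (f \o lambda) alpha
        = moreau_env dotprod f alpha \o lambda,
      forall X : symmx R n,
        prox trprod (f \o lambda) alpha X =
        [set Y : symmx R n | exists (y : 'rV[R]_n) (U : 'M[R]_n),
          [/\ prox dotprod f alpha (lambda X) y, orthogonal_diag X U &
              Y = U *m diag_mx y *m U^T :> 'M[R]_n]]
    & forall X Y : symmx R n, prox trprod (f \o lambda) alpha X Y ->
        simultaneous_ordered_spectral_decomposition X Y].
Proof.
split=> [|X|X Y].
- by apply/funext => X; apply: moreau_env_lambda.
- apply/seteqP; split=> [Y /prox_lambda_sub [] // Yprox YX|Y].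
    have [U [UUT YE XE]] := trprod_eq_dotprod_lambda YX.
    exists (lambda Y), U; split=> //; last by rewrite {1}YE.
    by split; rewrite // {2}XE.
  move=> [y [U [yprox XU YE]]].
  have -> : Y = conj_diag U y by apply: val_inj.
  exact: prox_conj_diag.
- move=> /prox_lambda_sub [] // _ /trprod_eq_dotprod_lambda [U [UUT YE XE]].
  (* The simultaneous decomposition conjugates in the direction opposite to [orthogonal_diag], hence
     the witness [U^T]. *)
  have UTU : U^T *m U = 1%:M := mulmx1C UUT.
  have diagE Z : Z = conj_diag U (lambda Z) -> U^T *m Z *m U^T^T = diag_mx (lambda Z).
    by move=> {1}-> /=; rewrite trmxK !mulmxA UTU mul1mx -mulmxA UTU mulmx1.
  by exists U^T; split; [rewrite /orthogonal_group /= trmxK | exact: diagE..].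
Qed.
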